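(* Let $\mathbf{Preord}$ be the category of non-empty preordered sets and preorder-preserving maps. Let $\mathbf{Equiv}$ be the class of all objects $(A,\sim)$ of $\mathbf{Preord}$ with $\sim$ an equivalence relation on $A$, and let $\mathbf{ParOrd}$ be the class of all objects $(A,\le)$ of $\mathbf{Preord}$ with $\le$ a partial order on $A$. Then the pair $(\mathbf{Equiv},\mathbf{ParOrd})$ is a pretorsion theory in the category $\mathbf{Preord}$.
   Context: A preorder on a set is a reflexive and transitive relation. Objects of $\mathbf{Preord}$ are pairs $(A,\rho)$ with $A$ a non-empty set and $\rho$ a preorder on $A$; morphisms $f\colon(A,\rho)\to(A',\rho')$ are the maps $f\colon A\to A'$ such that $a\rho b$ implies $f(a)\rho' f(b)$ for all $a,b\in A$. Let $\mathcal C$ be a category and $\mathcal Z$ a non-empty class of objects of $\mathcal C$. A morphism is $\mathcal Z$-trivial if it factors through an object of $\mathcal Z$; $\mathrm{Triv}_{\mathcal Z}(A,B)$ denotes the set of all $\mathcal Z$-trivial morphisms $A\to B$. A morphism $k\colon X\to A$ is a $\mathcal Z$-prekernel of $f\colon A\to A'$ if (1) $fk$ is $\mathcal Z$-trivial, and (2) whenever $\lambda\colon Y\to A$ is a morphism with $f\lambda$ $\mathcal Z$-trivial, there is a unique morphism $\lambda'\colon Y\to X$ with $\lambda=k\lambda'$. Dually, $p\colon A'\to X$ is a $\mathcal Z$-precokernel of $f\colon A\to A'$ if (1) $pf$ is $\mathcal Z$-trivial, and (2) whenever $\lambda\colon A'\to Y$ is a morphism with $\lambda f$ $\mathcal Z$-trivial,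 there is a unique morphism $\lambda_1\colon X\to Y$ with $\lambda=\lambda_1p$. A pair of morphisms $A\xrightarrow{f}B\xrightarrow{g}C$ is a short $\mathcal Z$-preexact sequence if $f$ is a $\mathcal Z$-prekernel of $g$ and $g$ is a $\mathcal Z$-precokernel of $f$. A pretorsion theory $(\mathcal T,\mathcal F)$ for $\mathcal C$ consists of two non-empty classes $\mathcal T,\mathcal F$ of objects of $\mathcal C$, closed under isomorphism, such that, with $\mathcal Z:=\mathcal T\cap\mathcal F$: (1) for every object $B$ of $\mathcal C$ there is a short $\mathcal Z$-preexact sequence $A\xrightarrow{f}B\xrightarrow{g}C$ with $A\in\mathcal T$ and $C\in\mathcal F$; (2) $\mathrm{Hom}_{\mathcal C}(T,F)=\mathrm{Triv}_{\mathcal Z}(T,F)$ for every $T\in\mathcal T$, $F\in\mathcal F$. *)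

(* Defs.v *)
(* [order] of Relation_Definitions is a partial order: reflexive, transitive
   and antisymmetric. *)
From Stdlib Require Import Relation_Definitions.

Set Implicit Arguments.

(* Equality of parallel morphisms is Leibniz equality. *)
Record Category : Type := {
  Ob :> Type;
  Hom : Ob -> Ob -> Type;
  idm : forall A : Ob, Hom A A;
  comp : forall A B C : Ob, Hom B C -> Hom A B -> Hom A C;
  comp_id_l : forall (A B : Ob) (f : Hom A B), comp (idm B) f = f;
  comp_id_r : forall (A B : Ob) (f : Hom A B), comp f (idm A) = f;
  comp_assoc : forall (A B C D : Ob) (h : Hom C D) (g : Hom B C) (f : Hom A B),
    comp h (comp g f) = comp (comp h g) f
}.

Arguments Hom {_} _ _.
Arguments idm {_} _.
Arguments comp {_ _ _ _} _ _.

Declare Scope cat_scope.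
Open Scope cat_scope.
Notation "g \o f" := (comp g f) (at level 40, left associativity) : cat_scope.

Definition obj_class (C : Category) : Type := C -> Prop.

Definition nonempty_class (C : Category) (P : obj_class C) : Prop :=
  exists A : C, P A.

Definition class_inter (C : Category) (P Q : obj_class C) : obj_class C :=
  fun A => P A /\ Q A.

Definition isomorphic (C : Category) (A B : C) : Prop :=
  exists (f : Hom A B) (g : Hom B A), g \o f = idm A /\ f \o g = idm B.

Arguments isomorphic {_} _ _.

Definition iso_closed (C : Category) (P : obj_class C) : Prop :=
  forall A B : C, isomorphic A B -> P A -> P B.

Definition trivial_mor (C : Category) (Z : obj_class C) (A B : C)
    (f : Hom A B) : Prop :=
  exists X : C, Z X /\ exists (u : Hom A X) (v : Hom X B), f = v \o u.

Arguments trivial_mor {_} _ {_ _} _.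

Definition is_prekernel (C : Category) (Z : obj_class C) (X A A' : C)
    (k : Hom X A) (f : Hom A A') : Prop :=
  trivial_mor Z (f \o k) /\
  forall (Y : C) (l : Hom Y A), trivial_mor Z (f \o l) ->
    exists! l' : Hom Y X, l = k \o l'.

Definition is_precokernel (C : Category) (Z : obj_class C) (A A' X : C)
    (p : Hom A' X) (f : Hom A A') : Prop :=
  trivial_mor Z (p \o f) /\
  forall (Y : C) (l : Hom A' Y), trivial_mor Z (l \o f) ->
    exists! l1 : Hom X Y, l = l1 \o p.

Arguments is_prekernel {_} _ {_ _ _} _ _.
Arguments is_precokernel {_} _ {_ _ _} _ _.

Definition short_preexact (C : Category) (Z : obj_class C) (A B D : C)
    (f : Hom A B) (g : Hom B D) : Prop :=
  is_prekernel Z f g /\ is_precokernel Z g f.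

Arguments short_preexact {_} _ {_ _ _} _ _.

Record pretorsion_theory (C : Category) (T F : obj_class C) : Prop := {
  torsion_nonempty : nonempty_class T;
  torsionfree_nonempty : nonempty_class F;
  torsion_iso_closed : iso_closed T;
  torsionfree_iso_closed : iso_closed F;
  preexact_seq : forall B : C, exists (A D : C) (f : Hom A B) (g : Hom B D),
    T A /\ F D /\ short_preexact (class_inter T F) f g;
  hom_trivial : forall A B : C, T A -> F B ->
    forall f : Hom A B, trivial_mor (class_inter T F) f
}.

Record preord_obj : Type := {
  carrier :> Type;
  rel : relation carrier;
  carrier_inhabited : inhabited carrier;
  rel_preorder : preorder carrier rel
}.

Record preord_hom (A B : preord_obj) : Type := MkPreordHom {
  map :> A -> B;
  map_monotone : forall a b : A, rel A a b -> rel B (map a) (map b)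
}.

Definition preord_id (A : preord_obj) : preord_hom A A :=
  @MkPreordHom A A (fun a => a) (fun a b H => H).

Definition preord_comp (A B C : preord_obj) (g : preord_hom B C)
    (f : preord_hom A B) : preord_hom A C :=
  @MkPreordHom A C (fun a => g (f a))
    (fun a b H => map_monotone g _ _ (map_monotone f a b H)).

Lemma preord_comp_id_l (A B : preord_obj) (f : preord_hom A B) :
  preord_comp (preord_id B) f = f.
Proof. destruct f; reflexivity. Qed.

Lemma preord_comp_id_r (A B : preord_obj) (f : preord_hom A B) :
  preord_comp f (preord_id A) = f.
Proof. destruct f; reflexivity. Qed.

Lemma preord_comp_assoc (A B C D : preord_obj) (h : preord_hom C D)
    (g : preord_hom B C) (f : preord_hom A B) :
  preord_comp h (preord_comp g f) = preord_comp (preord_comp h g) f.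
Proof. reflexivity. Qed.

Definition Preord : Category :=
  {| Ob := preord_obj; Hom := preord_hom;
     idm := preord_id; comp := preord_comp;
     comp_id_l := preord_comp_id_l; comp_id_r := preord_comp_id_r;
     comp_assoc := preord_comp_assoc |}.

Definition Equiv : obj_class Preord :=
  fun A : preord_obj => equivalence A (rel A).

Definition ParOrd : obj_class Preord :=
  fun A : preord_obj => order A (rel A).

(* Main.v *)
Require Import Defs.
From Stdlib Require Import Relation_Definitions ClassicalEpsilon
  FunctionalExtensionality PropExtensionality ProofIrrelevance.

(** An object that is both an equivalence and a partial order carries the
    equality relation, so the trivial morphisms are exactly the maps that
    identify any two related points ([trivial_iff]).  Given a preorder on [B],
    let [~] be its symmetric part, which is an equivalence.  The identity map
    [(B, ~) -> B] and the projection of [B] onto its quotient by [~], which is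
    partially ordered, form the required sequence.  Composing a map [l] into
    [B] with the projection gives a trivial map exactly when [l] sends related
    points to [~]-equivalent points, that is, when [l] is monotone into
    [(B, ~)].  A map out of [B] restricts to a trivial map on [(B, ~)] exactly
    when it is constant on [~]-classes, that is, when it descends to the
    quotient.

    The quotient is realised inside [B] by choosing one representative in
    each class.  The projection then has a monotone section, the inclusion of
    the representatives, which yields both the factorisation of a map through
    the quotient and its uniqueness. *)

Lemma preord_hom_ext (A B : preord_obj) (f g : preord_hom A B) :
  (forall a, f a = g a) -> f = g.
Proof.
  destruct f as [f mf], g as [g mg]; simpl; intro E.
  apply functional_extensionality in E; subst g.
  f_equal; apply proof_irrelevance.
Qed.

Lemma preord_hom_app (A B : preord_obj) (f g : preord_hom A B) (a : A) :
  f = g -> f a = g a.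
Proof. now intros ->. Qed.

(** * Trivial morphisms *)

Lemma eq_preorder (X : Type) : preorder X eq.
Proof. split; red; congruence. Qed.

Definition discrete (X : Type) (i : inhabited X) : preord_obj :=
  {| carrier := X; rel := eq; carrier_inhabited := i;
     rel_preorder := eq_preorder X |}.

Lemma discrete_Equiv (X : Type) (i : inhabited X) : Equiv (discrete X i).
Proof. split; red; simpl; congruence. Qed.

Lemma discrete_ParOrd (X : Type) (i : inhabited X) : ParOrd (discrete X i).
Proof. split; red; simpl; congruence. Qed.

(** A map that identifies related points factors through its own codomain
    equipped with the equality relation. *)
Lemma trivial_iff (A B : preord_obj) (f : preord_hom A B) :
  @trivial_mor Preord (class_inter Equiv ParOrd) A B f <->
  forall a b : A, rel A a b -> f a = f b.
Proof.
  split.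
  - intros [X [[eX oX] [u [v ->]]]] a b H; simpl; f_equal.
    apply (ord_antisym _ _ oX).
    + now apply (map_monotone u).
    + now apply (equiv_sym _ _ eX), (map_monotone u).
  - intro E.
    exists (discrete B (carrier_inhabited B)).
    split; [split; [apply discrete_Equiv | apply discrete_ParOrd] |].
    assert (refl : forall a b : B, a = b -> rel B a b).
    { intros a b <-; apply (preord_refl _ _ (rel_preorder B)). }
    exists (@MkPreordHom A (discrete B (carrier_inhabited B)) f E).
    exists (@MkPreordHom (discrete B (carrier_inhabited B)) B (fun b => b) refl).
    now apply preord_hom_ext.
Qed.

Lemma Equiv_ParOrd_trivial (A B : preord_obj) (f : preord_hom A B) :
  Equiv A -> ParOrd B ->
  @trivial_mor Preord (class_inter Equiv ParOrd) A B f.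
Proof.
  intros eA oB; apply trivial_iff; intros a b H.
  apply (ord_antisym _ _ oB); apply map_monotone; trivial.
  now apply (equiv_sym _ _ eA).
Qed.

(** * Closure under isomorphism *)

Lemma Equiv_iso_closed : iso_closed Equiv.
Proof.
  intros A B [f [g [_ fg]]] eA.
  assert (K : forall b : B, map f (map g b) = b)
    by (intro b; exact (preord_hom_app _ _ _ _ b fg)).
  destruct (rel_preorder B) as [rB tB]; split; trivial.
  intros x y H; rewrite <- (K x), <- (K y).
  now apply (map_monotone f), (equiv_sym _ _ eA), (map_monotone g).
Qed.

Lemma ParOrd_iso_closed : iso_closed ParOrd.
Proof.
  intros A B [f [g [_ fg]]] oA.
  assert (K : forall b : B, map f (map g b) = b)
    by (intro b; exact (preord_hom_app _ _ _ _ b fg)).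
  destruct (rel_preorder B) as [rB tB]; split; trivial.
  intros x y H H'; rewrite <- (K x), <- (K y); f_equal.
  now apply (ord_antisym _ _ oA); apply (map_monotone g).
Qed.

(** * The preexact sequence of a preorder *)

Definition sym_rel (B : preord_obj) : relation B :=
  fun a b => rel B a b /\ rel B b a.

Lemma sym_rel_equivalence (B : preord_obj) : equivalence B (sym_rel B).
Proof.
  destruct (rel_preorder B) as [r t]; split.
  - now intro x; split.
  - intros x y z [] []; split; eapply t; eauto.
  - now intros x y [].
Qed.

Definition sym_core (B : preord_obj) : preord_obj :=
  {| carrier := B; rel := sym_rel B;
     carrier_inhabited := carrier_inhabited B;
     rel_preorder := Build_preorder _ _
       (equiv_refl _ _ (sym_rel_equivalence B))
       (equiv_trans _ _ (sym_rel_equivalence B)) |}.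

Definition sym_core_incl (B : preord_obj) : preord_hom (sym_core B) B :=
  @MkPreordHom (sym_core B) B (fun b => b) (fun a b H => proj1 H).

(** Equivalent points define the same class as a predicate, and the choice
    operator depends only on that predicate. *)
Lemma class_representatives (X : Type) (R : relation X) :
  inhabited X -> equivalence X R ->
  exists r : X -> X,
    (forall x, R (r x) x) /\ (forall x y, R x y -> r x = r y).
Proof.
  intros i [refl trans sym].
  exists (fun x => epsilon i (fun y => R y x)); split.
  - intro x; apply (epsilon_spec i (fun y => R y x)); now exists x.
  - intros x y H; f_equal.
    apply functional_extensionality; intro z.
    apply propositional_extensionality; split; intro; eauto.
Qed.

(** [D] is the set of chosen representatives with the order induced from [B].
    Induced orders are antisymmetric here because two equivalent
    representatives are equal; the section [s] is the inclusion. *)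
Lemma split_quotient (B : preord_obj) :
  exists (D : preord_obj) (p : preord_hom B D) (s : preord_hom D B),
    ParOrd D /\ (forall d, p (s d) = d) /\
    (forall a b, p a = p b <-> sym_rel B a b).
Proof.
  destruct (class_representatives B (sym_rel B) (carrier_inhabited B)
              (sym_rel_equivalence B)) as [r [rR rE]].
  destruct (sym_rel_equivalence B) as [_ strans ssym].
  destruct (rel_preorder B) as [refl trans].
  assert (idem : forall b, r (r b) = r b) by (intro b; apply rE, rR).
  assert (ext : forall d e : {b : B | r b = b},
             proj1_sig d = proj1_sig e -> d = e).
  { intros [d hd] [e he]; simpl; intro; subst e.
    f_equal; apply proof_irrelevance. }
  pose (relD := fun d e : {b : B | r b = b} =>
                  rel B (proj1_sig d) (proj1_sig e)).
  assert (preD : preorder _ relD).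
  { split; [intro d; apply refl | intros d e f; apply trans]. }
  assert (inhD : inhabited {b : B | r b = b}).
  { destruct (carrier_inhabited B) as [b].
    exact (inhabits (exist _ (r b) (idem b))). }
  pose (D := {| carrier := {b : B | r b = b}; rel := relD;
                carrier_inhabited := inhD; rel_preorder := preD |}).
  pose (p0 := fun b => exist (fun b => r b = b) (r b) (idem b)).
  assert (p_mono : forall a b : B, rel B a b -> rel D (p0 a) (p0 b)).
  { intros a b H; unfold D, relD; simpl.
    apply (trans _ a); [apply rR |].
    apply (trans _ b); [trivial | apply rR]. }
  pose (s0 := fun d : D => proj1_sig d).
  exists D, (@MkPreordHom B D p0 p_mono),
    (@MkPreordHom D B s0 (fun d e H => H)).
  split; [| split].
  - destruct preD as [reflD transD]; split; trivial.
    intros d e H H'; apply ext.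
    rewrite <- (proj2_sig d), <- (proj2_sig e).
    now apply rE; split.
  - intro d; apply ext; exact (proj2_sig d).
  - intros a b; split; intro H.
    + apply (f_equal (@proj1_sig _ _)) in H; simpl in H.
      apply (strans _ (r a)); [apply ssym, rR |].
      rewrite H; apply rR.
    + apply ext; simpl; now apply rE.
Qed.

Lemma sym_core_incl_prekernel (B D : preord_obj) (p : preord_hom B D)
    (p_eq : forall a b, p a = p b <-> sym_rel B a b) :
  @is_prekernel Preord (class_inter Equiv ParOrd) (sym_core B) B D
    (sym_core_incl B) p.
Proof.
  split.
  - apply trivial_iff; intros a b H; now apply p_eq.
  - intros Y l T.
    pose proof (proj1 (trivial_iff _ _ _) T) as E; simpl in E.
    exists (@MkPreordHom Y (sym_core B) (map l)
              (fun a b H => proj1 (p_eq _ _) (E a b H))); split.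
    + now apply preord_hom_ext.
    + intros l' ->; now apply preord_hom_ext.
Qed.

(** The factorisation of [l] through [p] can only be [l] composed with [s];
    it is one because [s (p b)] is equivalent to [b]. *)
Lemma split_quotient_precokernel (B D : preord_obj) (p : preord_hom B D)
    (s : preord_hom D B) (section : forall d, p (s d) = d)
    (p_eq : forall a b, p a = p b <-> sym_rel B a b) :
  @is_precokernel Preord (class_inter Equiv ParOrd) (sym_core B) B D
    p (sym_core_incl B).
Proof.
  split.
  - apply trivial_iff; intros a b H; now apply p_eq.
  - intros Y l T.
    pose proof (proj1 (trivial_iff _ _ _) T) as E; simpl in E.
    exists (preord_comp l s); split.
    + apply preord_hom_ext; intro b; simpl.
      apply E, p_eq; now rewrite section.
    + intros l1 ->; apply preord_hom_ext; intro d; simpl.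
      now rewrite section.
Qed.

Theorem mainTheorem1 : pretorsion_theory Equiv ParOrd.
Proof.
  split.
  - exists (discrete unit (inhabits tt)); apply discrete_Equiv.
  - exists (discrete unit (inhabits tt)); apply discrete_ParOrd.
  - exact Equiv_iso_closed.
  - exact ParOrd_iso_closed.
  - intro B.
    destruct (split_quotient B) as [D [p [s [oD [ps pE]]]]].
    exists (sym_core B), D, (sym_core_incl B), p.
    split; [exact (sym_rel_equivalence B) | split; [exact oD | split]].
    + now apply sym_core_incl_prekernel.
    + exact (split_quotient_precokernel B D p s ps pE).
  - intros A B eA oB f; now apply Equiv_ParOrd_trivial.
Qed.
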